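(* Let $A_0, A_1 : [\sigma_0,\sigma_1]\times[\tau_0,\tau_1] \to \mathbb{C}^{n\times n}$ be continuously differentiable matrix-valued functions. For $\sigma\in[\sigma_0,\sigma_1]$ and $\tau\in[\tau_0,\tau_1]$ define the path-ordered (product-integral) phase factors $$P(\sigma,\sigma_0;\tau)=\prod_{\sigma_0}^{\sigma} e^{A_1(\sigma';\tau)\,d\sigma'},\qquad Q(\sigma;\tau,\tau_0)=\prod_{\tau_0}^{\tau} e^{A_0(\sigma;\tau')\,d\tau'},$$ the matrix $$T(\sigma;\tau)=P(\sigma,\sigma_0;\tau)\,Q(\sigma_0;\tau,\tau_0),$$ and the loop operator $$W=Q^{-1}(\sigma_0;\tau,\tau_0)\,P^{-1}(\sigma,\sigma_0;\tau)\,Q(\sigma;\tau,\tau_0)\,P(\sigma,\sigma_0;\tau_0)=T^{-1}(\sigma;\tau)\,Q(\sigma;\tau,\tau_0)\,P(\sigma,\sigma_0;\tau_0).$$ Then $$W=\prod_{\tau_0}^{\tau} e^{\,T^{-1}(\sigma;\tau')\,[A_0(\sigma;\tau')-L_\tau T(\sigma;\tau')]\,T(\sigma;\tau')\,d\tau'},$$ where $L_\tau T(\sigma;\tau')=\big(\partial_{\tau'}T(\sigma;\tau')\big)\,T^{-1}(\sigma;\tau')$.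
   Context: Product integral: for a continuous $B:[a,b]\to\mathbb{C}^{n\times n}$ and $x\in[a,b]$, $\prod_a^x e^{B(s)ds}$ is the limit, as the mesh of the partition $a=s_0<s_1<\dots<s_m=x$ tends to $0$, of the ordered product $e^{B(s_m)\Delta s_m}e^{B(s_{m-1})\Delta s_{m-1}}\cdots e^{B(s_1)\Delta s_1}$ with $\Delta s_k=s_k-s_{k-1}$ (later points to the left); equivalently it is the unique solution $F(x)$ of $F'(x)=B(x)F(x)$, $F(a)=I$. It is an invertible matrix, and $P^{-1},Q^{-1},T^{-1}$ denote matrix inverses. In $P(\sigma,\sigma_0;\tau)$ the ordering is in $\sigma'$ with $\tau$ a fixed parameter; in $Q(\sigma;\tau,\tau_0)$ the ordering is in $\tau'$ with $\sigma$ a fixed parameter. The operator $W$ is the holonomy (Wilson loop) around the boundary of the parameter rectangle $[\sigma_0,\sigma]\times[\tau_0,\tau]$. *)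

(* Defs.v *)
From HB Require Import structures.
From mathcomp Require Import all_boot all_order all_algebra.
From mathcomp Require Import all_classical all_reals all_analysis.
From mathcomp Require Export complex.
Import Order.TTheory GRing.Theory Num.Theory.
Import numFieldNormedType.Exports.

Set Implicit Arguments.
Unset Strict Implicit.
Unset Printing Implicit Defensive.

Local Open Scope ring_scope.
Local Open Scope classical_set_scope.

(* R[i] is a numFieldType; equip it with its canonical normed (hence
   topological) structure as a normed module over itself, so that complex
   matrices 'M[R[i]]_n get their usual (entrywise-max-norm) topology. *)
HB.instance Definition _ (R : rcfType) := NormedModule.copy R[i] (R[i])^o.

Section Defs.
Context {R : realType} {n : nat}.
Local Notation M := 'M[R[i]]_n.

Definition has_deriv_within (D : set R) (f : R -> M) (t : R) (d : M) : Prop :=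
  ((u - t)^-1)%:C%C *: (f u - f t) @[u --> within (D `\ t) (nbhs t)] --> d.

(* The derivative relative to D (chosen; 0 if it does not exist). *)
Definition deriv_within (D : set R) (f : R -> M) (t : R) : M :=
  match pselect (exists d, has_deriv_within D f t d) with
  | left h => projT1 (cid h)
  | right _ => 0
  end.

Definition prodint_sol (B : R -> M) (a b : R) (F : R -> M) : Prop :=
  F a = 1 /\
  forall s, a <= s <= b ->
    has_deriv_within [set u | a <= u <= b] F s (B s *m F s).

(* Product integral  prod_a^x e^{B(s) ds}: the value at x of the (unique)
   solution of F' = B F, F(a) = I on [a, x]. *)
Definition prodint (B : R -> M) (a x : R) : M :=
  match pselect (exists F, prodint_sol B a x F) with
  | left h => projT1 (cid h) x
  | right _ => 1
  end.

Definition rect (s0 s1 t0 t1 : R) : set (R * R) :=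
  [set p | s0 <= p.1 <= s1 /\ t0 <= p.2 <= t1].

Definition C1_rect (A : R -> R -> M) (s0 s1 t0 t1 : R) : Prop :=
  exists Ds Dt : R -> R -> M,
    (forall s t, s0 <= s <= s1 -> t0 <= t <= t1 ->
       has_deriv_within [set u | s0 <= u <= s1] (fun u => A u t) s (Ds s t)) /\
    (forall s t, s0 <= s <= s1 -> t0 <= t <= t1 ->
       has_deriv_within [set u | t0 <= u <= t1] (A s) t (Dt s t)) /\
    {within rect s0 s1 t0 t1, continuous (fun p : R * R => A p.1 p.2)} /\
    {within rect s0 s1 t0 t1, continuous (fun p : R * R => Ds p.1 p.2)} /\
    {within rect s0 s1 t0 t1, continuous (fun p : R * R => Dt p.1 p.2)}.

End Defs.

(* Main.v *)
Require Import Defs.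
From HB Require Import structures.
From mathcomp Require Import all_boot all_order all_algebra.
From mathcomp Require Import all_classical all_reals all_analysis.
From mathcomp Require Import complex.
From mathcomp Require Import ring lra.
Import Order.TTheory GRing.Theory Num.Theory.
Import numFieldNormedType.Exports.
Local Open Scope ring_scope.
Local Open Scope classical_set_scope.

Set Implicit Arguments.
Unset Strict Implicit.

(** Fix sigma and put V(tau) = T^-1 Q P(sigma, sigma_0; tau_0). Differentiating,
    V' = T^-1 (A_0 - T' T^-1) T V and V(tau_0) = 1, so V is the product integral
    on the right-hand side: V is invertible, and for any other solution F the
    derivative of V^-1 F vanishes.
    Two facts feed this. Linear systems F' = B F with B continuous have invertible
    solutions (Picard iteration in the weighted norm sup e^(-2K(x-a)) |F(x)|; the
    transposed system solves the adjoint equation G' = - G B, and G F = 1). And P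
    is differentiable in the parameter tau, which follows from Duhamel's formula
    for P(., t)^-1 P(., u) together with the uniform continuity of the derivative
    of A_1 in tau.
    Everything is estimated with the real-valued submultiplicative norm
    mnorm A = sum |Re A_ij| + |Im A_ij|. *)

Local Notation seg a b := [set u | a <= u <= b].

(** * The sum norm of real and imaginary parts on complex numbers *)

Section norm.
Context {R : realType}.
Implicit Types z w : R[i].

Definition cnorm z : R := `|complex.Re z| + `|complex.Im z|.

Lemma cnorm_ge0 z : 0 <= cnorm z. Proof. exact: addr_ge0. Qed.

Lemma cnorm0 : cnorm 0 = 0. Proof. by rewrite /cnorm /= normr0 addr0. Qed.

Lemma cnormD z w : cnorm (z + w) <= cnorm z + cnorm w.
Proof.
case: z w => [a b] [c d]; rewrite /cnorm /= addrACA.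
by apply: lerD; exact: ler_normD.
Qed.

Lemma cnormN z : cnorm (- z) = cnorm z.
Proof. by case: z => a b; rewrite /cnorm /= !normrN. Qed.

Lemma cnormM z w : cnorm (z * w) <= cnorm z * cnorm w.
Proof.
case: z w => [a b] [c d]; rewrite /cnorm /=.
apply: (@le_trans _ _ ((`|a * c| + `|b * d|) + (`|a * d| + `|b * c|))).
  by apply: lerD; [exact: ler_normB|exact: ler_normD].
rewrite !normrM; lra.
Qed.

Lemma cnormZ (c : R) z : cnorm (c%:C%C * z) = `|c| * cnorm z.
Proof.
case: z => a b; rewrite /cnorm /= mulrDr -!normrM.
by rewrite mul0r subr0 mul0r addr0.
Qed.

(** The modulus dominates each of the two parts, whence the factor 2. It takes values in [R[i]], so
    the real [cnorm] is embedded before the comparison. *)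
Lemma ler_cnorm_norm z : (cnorm z)%:C%C <= 2 * `|z|.
Proof.
case: z => a b; rewrite /cnorm normc_def /=.
have -> : 2 = (2 : R)%:C%C :> R[i] by rewrite rmorph_nat.
rewrite -rmorphM lecR.
have h c d : `|c| <= Num.sqrt (c ^+ 2 + d ^+ 2) :> R.
  by rewrite -sqrtr_sqr ler_wsqrtr// lerDl sqr_ge0.
by have := h a b; have := h b a; rewrite [b ^+ 2 + _]addrC; lra.
Qed.

Lemma ler_norm_cnorm z : `|z| <= (cnorm z)%:C%C.
Proof.
case: z => a b; rewrite /cnorm normc_def /= lecR.
rewrite -[leRHS]ger0_norm ?addr_ge0// -[leRHS]sqrtr_sqr ler_wsqrtr//.
rewrite sqrrD -!normrX [`|a ^+ 2|]ger0_norm ?[`|b ^+ 2|]ger0_norm ?sqr_ge0//.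
have := mulr_ge0 (normr_ge0 a) (normr_ge0 b); lra.
Qed.

End norm.

(** * The entrywise sum norm on matrices and its norming functionals *)

Section mnorm.
Context {R : realType} {n : nat}.
Local Notation M := 'M[R[i]]_n.
Implicit Types A B : M.

Definition mnorm A : R := \sum_i \sum_j cnorm (A i j).

Lemma mnorm_ge0 A : 0 <= mnorm A.
Proof. by apply: sumr_ge0 => i _; apply: sumr_ge0 => j _; exact: cnorm_ge0. Qed.

Lemma mnorm0 : mnorm 0 = 0.
Proof. by rewrite /mnorm big1// => i _; rewrite big1// => j _; rewrite mxE cnorm0. Qed.

Lemma mnormD A B : mnorm (A + B) <= mnorm A + mnorm B.
Proof.
rewrite /mnorm -big_split/=; apply: ler_sum => i _.
by rewrite -big_split/=; apply: ler_sum => j _; rewrite mxE; exact: cnormD.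
Qed.

Lemma mnormN A : mnorm (- A) = mnorm A.
Proof.
by apply: eq_bigr => i _; apply: eq_bigr => j _; rewrite mxE cnormN.
Qed.

Lemma mnormB A B : mnorm (A - B) <= mnorm A + mnorm B.
Proof. by rewrite -(mnormN B); exact: mnormD. Qed.

Lemma mnormBC A B : mnorm (A - B) = mnorm (B - A).
Proof. by rewrite -mnormN opprB. Qed.

Lemma mnormZ (c : R) A : mnorm (c%:C%C *: A) = `|c| * mnorm A.
Proof.
rewrite /mnorm mulr_sumr; apply: eq_bigr => i _.
by rewrite mulr_sumr; apply: eq_bigr => j _; rewrite mxE cnormZ.
Qed.

Lemma mnormT A : mnorm A^T = mnorm A.
Proof.
rewrite /mnorm exchange_big/=.
by apply: eq_bigr => i _; apply: eq_bigr => j _; rewrite mxE.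
Qed.

Lemma mnorm_entry A i j : cnorm (A i j) <= mnorm A.
Proof.
rewrite /mnorm (bigD1 i)//= (bigD1 j)//= -addrA lerDl addr_ge0//.
  by apply: sumr_ge0 => k _; exact: cnorm_ge0.
by apply: sumr_ge0 => k _; apply: sumr_ge0 => l _; exact: cnorm_ge0.
Qed.

(** Expanded, the product of the norms runs over all quadruples (i, k, l, j); the entries of the
    matrix product only meet the terms with l = k, and the others are nonnegative. *)
Lemma mnormM A B : mnorm (A *m B) <= mnorm A * mnorm B.
Proof.
have -> : mnorm A * mnorm B =
    \sum_i \sum_k \sum_l \sum_j cnorm (A i k) * cnorm (B l j).
  rewrite /mnorm mulr_suml; apply: eq_bigr => i _.
  rewrite mulr_suml; apply: eq_bigr => k _.
  rewrite mulr_sumr; apply: eq_bigr => l _.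
  by rewrite mulr_sumr.
rewrite /mnorm; apply: ler_sum => i _.
apply: (@le_trans _ _ (\sum_j \sum_k cnorm (A i k) * cnorm (B k j))).
  apply: ler_sum => j _; rewrite mxE.
  elim/big_ind2 : _ => [|x1 x2 y1 y2 h1 h2|k _]; first by rewrite cnorm0.
    exact: le_trans (cnormD _ _) (lerD h1 h2).
  exact: cnormM.
rewrite exchange_big/=; apply: ler_sum => k _.
rewrite [leRHS](bigD1 k)//= lerDl.
by apply: sumr_ge0 => l _; apply: sumr_ge0 => j _; rewrite mulr_ge0 ?cnorm_ge0.
Qed.

Lemma mnorm_le0_eq0 A : mnorm A <= 0 -> A = 0.
Proof.
move=> A0; apply/matrixP => i j; rewrite mxE.
have := le_trans (mnorm_entry A i j) A0.
case: (A i j) => a b; rewrite /cnorm /= => h.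
have a0 : `|a| = 0 by move: (normr_ge0 a) (normr_ge0 b); lra.
have b0 : `|b| = 0 by move: (normr_ge0 a) (normr_ge0 b); lra.
by move: a0 b0 => /normr0_eq0-> /normr0_eq0->.
Qed.

(* The norming functional of [S]; it reduces the mean value inequality for
   matrices to the real one. *)
Definition support_fun (S A : M) : R :=
  \sum_i \sum_j (Num.sg (complex.Re (S i j)) * complex.Re (A i j)
               + Num.sg (complex.Im (S i j)) * complex.Im (A i j)).

Lemma support_funD S A B :
  support_fun S (A + B) = support_fun S A + support_fun S B.
Proof.
rewrite /support_fun -big_split/=; apply: eq_bigr => i _.
rewrite -big_split/=; apply: eq_bigr => j _; rewrite mxE.
by case: (A i j) (B i j) => [a b] [c d] /=; ring.
Qed.

Lemma support_funZ S (c : R) A : support_fun S (c%:C%C *: A) = c * support_fun S A.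
Proof.
rewrite /support_fun mulr_sumr; apply: eq_bigr => i _.
rewrite mulr_sumr; apply: eq_bigr => j _; rewrite mxE.
by case: (A i j) => [a b] /=; ring.
Qed.

Lemma support_funN S A : support_fun S (- A) = - support_fun S A.
Proof.
have -> : - A = (-1)%:C%C *: A by rewrite rmorphN1 scaleN1r.
by rewrite support_funZ mulN1r.
Qed.

Lemma support_funS S : support_fun S S = mnorm S.
Proof.
by apply: eq_bigr => i _; apply: eq_bigr => j _; rewrite /cnorm !normrEsg.
Qed.

Lemma support_fun_le S A : `|support_fun S A| <= mnorm A.
Proof.
have sgle (x y : R) : `|Num.sg x * y| <= `|y|.
  by rewrite normrM normr_sg; case: (x != 0); rewrite ?mul1r ?mul0r.
apply: le_trans (ler_norm_sum _ _ _) _; apply: ler_sum => i _.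
apply: le_trans (ler_norm_sum _ _ _) _; apply: ler_sum => j _.
by apply: le_trans (ler_normD _ _) _; apply: lerD.
Qed.

End mnorm.

(** * From filter limits to epsilon-delta estimates in [mnorm] *)

Section bridge.
Context {R : realType} {n : nat}.
Local Notation M := 'M[R[i]]_n.

(** The matrix topology is given by entrywise balls with radii in [R[i]]; equivalence of norms turns
    them into real bounds on [mnorm]. *)
Lemma cvg_mnormP {T : Type} (F : set_system T) {FF : Filter F} (f : T -> M) (l : M) :
  f x @[x --> F] --> l <->
  forall e : R, 0 < e -> \forall x \near F, mnorm (f x - l) <= e.
Proof.
split=> [/cvg_ballP fl e e0|fl].
  (* There are n * n entries, each losing the factor 2 of [ler_cnorm_norm]; the added 1 keeps [m]
     positive when n = 0. *)
  pose m := 2 * (n * n)%:R + 1 : R.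
  have m0 : 0 < m by rewrite ltr_wpDl// mulr_ge0.
  have em0 : 0 < (e / m)%:C%C :> R[i] by rewrite ltcR divr_gt0.
  apply: filterS (fl _ em0) => x [_ H].
  rewrite mnormBC.
  apply: (@le_trans _ _ (\sum_(i < n) \sum_(j < n) 2 * (e / m))).
    apply: ler_sum => i _; apply: ler_sum => j _; rewrite !mxE.
    rewrite -lecR; apply: le_trans (ler_cnorm_norm _) _.
    have -> : 2 = (2 : R)%:C%C :> R[i] by rewrite rmorph_nat.
    have /ltW := H i j => h.
    by rewrite rmorphM ler_wpM2l// ler0c.
  have qm : e / m * m = e by rewrite divfK// gt_eqF.
  have q0 : 0 < e / m by rewrite divr_gt0.
  rewrite !sumr_const !card_ord -mulrnA -mulr_natr.
  by move: qm q0; rewrite {2}/m; lra.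
apply/cvg_ballP => e e0.
(* A positive element of [R[i]] is real, so the radius can be replaced by its real part. *)
have -> : e = (complex.Re e)%:C%C by rewrite RRe_real// gtr0_real.
have e0' : 0 < complex.Re e by move: e0; rewrite ltcE => /andP[].
have e20 : 0 < complex.Re e / 2 by rewrite divr_gt0.
apply: filterS (fl _ e20) => x H.
split; first by rewrite ltcR.
move=> i j; rewrite /ball /=.
apply: le_lt_trans (ler_norm_cnorm _) _; rewrite ltcR.
have := mnorm_entry (l - f x) i j; rewrite mnormBC !mxE => h.
by move: H h e0'; lra.
Qed.

Lemma near_withinP {V : pseudoMetricType R} (D : set V) (t : V) (P : set V) :
  (\forall u \near within D (nbhs t), P u) <->
  exists2 dl, 0 < dl & forall u, D u -> ball t dl u -> P u.
Proof.
rewrite near_withinE; split => [/nbhs_ballP[dl /= dl0 H]|[dl dl0 H]].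
  by exists dl => // u Du tu; exact: H.
by apply/nbhs_ballP; exists dl => // u tu Du; exact: H.
Qed.

(** The remainder form avoids division, so that u = t need not be excluded. *)
Definition mderiv (D : set R) (F : R -> M) (t : R) (d : M) : Prop :=
  forall e, 0 < e -> exists2 dl, 0 < dl & forall u, D u -> `|u - t| < dl ->
    mnorm (F u - F t - (u - t)%:C%C *: d) <= e * `|u - t|.

Lemma has_deriv_withinP D (F : R -> M) t d :
  has_deriv_within D F t d <-> mderiv D F t d.
Proof.
have qE u : u != t -> ((u - t)^-1)%:C%C *: (F u - F t) - d =
    ((u - t)^-1)%:C%C *: (F u - F t - (u - t)%:C%C *: d).
  move=> ut; rewrite [RHS]scalerBr scalerA -rmorphM mulVf ?subr_eq0//.
  by rewrite scale1r.
rewrite /has_deriv_within; split=> [/cvg_mnormP H e e0|H].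
  have /near_withinP[dl dl0 {}H] := H _ e0.
  exists dl => // u Du ut; have [->|nut] := eqVneq u t.
    by rewrite !subrr scale0r subr0 mnorm0 normr0 mulr0.
  have := H u; rewrite qE// mnormZ normfV ler_pdivrMl ?normr_gt0 ?subr_eq0//.
  rewrite mulrC; apply => //; first by split => //= /eqP; rewrite (negbTE nut).
  by rewrite /ball /= distrC.
apply/cvg_mnormP => e e0; have [dl dl0 {}H] := H _ e0.
apply/near_withinP; exists dl => // u [Du /= /eqP nut]; rewrite /ball /= distrC => ut.
rewrite qE// mnormZ normfV ler_pdivrMl ?normr_gt0 ?subr_eq0//.
by rewrite mulrC; exact: H.
Qed.

End bridge.

(** * Real derivatives relative to a set, and monotonicity *)

Section real_deriv.
Context {R : realType}.
Implicit Types (D : set R) (f g : R -> R).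

(** The real counterpart of [mderiv]; at an endpoint of a segment it is a one-sided derivative. *)
Definition rderiv D f t d := forall e : R, 0 < e ->
  exists2 dl, 0 < dl & forall u, D u -> `|u - t| < dl ->
    `|f u - f t - (u - t) * d| <= e * `|u - t|.

Lemma rderivD D f g t d d' :
  rderiv D f t d -> rderiv D g t d' -> rderiv D (f \+ g) t (d + d').
Proof.
move=> fd gd e e0; have e20 : 0 < e / 2 by rewrite divr_gt0.
have [k1 k10 {}fd] := fd _ e20; have [k2 k20 {}gd] := gd _ e20.
exists (Num.min k1 k2); first by rewrite lt_min k10.
move=> u Du; rewrite lt_min => /andP[/(fd _ Du) h1 /(gd _ Du) h2] /=.
have -> : f u + g u - (f t + g t) - (u - t) * (d + d') =
  (f u - f t - (u - t) * d) + (g u - g t - (u - t) * d') by ring.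
by apply: le_trans (ler_normD _ _) _; move: h1 h2; lra.
Qed.

Lemma rderivN D f t d : rderiv D f t d -> rderiv D (\- f) t (- d).
Proof.
move=> fd e e0; have [k k0 {}fd] := fd _ e0; exists k => // u Du ut /=.
have -> : - f u - - f t - (u - t) * - d = - (f u - f t - (u - t) * d) by ring.
by rewrite normrN; exact: fd.
Qed.

Lemma rderiv_linear D (c t : R) : rderiv D ( *%R c) t c.
Proof.
move=> e e0; exists 1 => // u _ _.
have -> : c * u - c * t - (u - t) * c = 0 by ring.
by rewrite normr0 mulr_ge0// ltW.
Qed.

Lemma is_derive_rderiv D f (t d : R) : is_derive t 1 f d -> rderiv D f t d.
Proof.
move=> fd e e0; have [/cvg_ex[l /= lf] <-] := fd.
have -> : 'D_1 f t = l by exact/cvg_lim.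
move: lf => /cvgrPdist_le/(_ _ e0)/nbhs_ballP[k /= k0 H].
exists k => // u Du ut; have [->|nut] := eqVneq u t.
  by rewrite !subrr mul0r subr0 normr0 mulr0.
have ut0 : u - t != 0 by rewrite subr_eq0.
have := H (u - t); rewrite /ball /= sub0r normrN => /(_ ut ut0).
rewrite [_ *: 1]mulr1 subrK => h.
have -> : f u - f t - (u - t) * l = - ((u - t) * (l - (u - t)^-1 * (f u - f t))).
  by rewrite mulrBr mulrA divff// mul1r; ring.
by rewrite normrN normrM mulrC ler_wpM2r.
Qed.

Lemma rderiv_is_derive (a b : R) f (t d : R) :
  a < t < b -> rderiv (seg a b) f t d -> is_derive t 1 f d.
Proof.
move=> /andP[at_ tb] fd.
have fl : h^-1 *: (f (h *: 1 + t) - f t) @[h --> 0^'] --> d.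
  apply/cvgrPdist_le => e e0; have [k k0 {}fd] := fd _ e0.
  near=> h.
  have h0 : h != 0 by near: h; exact: nbhs_dnbhs_neq.
  have hk : `|h| < k by near: h; exact: dnbhs0_lt.
  have h1 : `|h| < t - a by near: h; apply: dnbhs0_lt; rewrite subr_gt0.
  have h2 : `|h| < b - t by near: h; apply: dnbhs0_lt; rewrite subr_gt0.
  have := fd (h + t); rewrite addrK /= => /(_ _ hk).
  have -> : a <= h + t <= b.
    move: h1 h2; rewrite !ltr_norml => /andP[? ?] /andP[? ?].
    by apply/andP; split; lra.
  move=> /(_ isT) h3; rewrite [h *: 1]mulr1.
  have -> : d - h^-1 *: (f (h + t) - f t) = - (h^-1 * (f (h + t) - f t - h * d)).
    by rewrite [in RHS]mulrBr mulrA mulVf// mul1r opprB.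
  by rewrite normrN normrM normfV ler_pdivrMl ?normr_gt0// [leRHS]mulrC.
apply: DeriveDef; first by apply/cvg_ex; exists d.
exact/cvg_lim.
Unshelve. all: by end_near. Qed.

Lemma rderiv_continuous (a b : R) f df :
  (forall t, a <= t <= b -> rderiv (seg a b) f t (df t)) ->
  {within `[a, b], continuous f}.
Proof.
move=> fd; apply/subspace_continuousP => t /= tab.
apply/cvgrPdist_le => e e0; apply/near_withinP.
have [k k0 {}fd] := fd t tab _ ltr01.
have D0 : 0 < `|df t| + 1 by rewrite ltr_wpDl.
exists (Num.min k (e / (`|df t| + 1))); first by rewrite lt_min k0 divr_gt0.
move=> u /= uab; rewrite /ball /= distrC lt_min => /andP[uk].
rewrite ltr_pdivlMr// => ue.
have h := fd u uab uk; rewrite distrC.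
have -> : f u - f t = (f u - f t - (u - t) * df t) + (u - t) * df t by ring.
by apply: le_trans (ler_normD _ _) _; rewrite normrM; move: ue h; lra.
Qed.

(** The mean value theorem needs two-sided derivatives only in the open interval, where
    [rderiv_is_derive] provides them; at the endpoints the relative derivative still gives
    continuity. *)
Lemma rderiv_ge0_le (a b : R) f df : a <= b ->
  (forall t, a <= t <= b -> rderiv (seg a b) f t (df t)) ->
  (forall t, a <= t <= b -> 0 <= df t) -> f a <= f b.
Proof.
move=> ab fd df0.
have [||c] := @MVT_segment R f df a b ab.
- move=> x; rewrite in_itv /= => /andP[ax xb].
  by apply: (@rderiv_is_derive a b); rewrite ?ax//; apply: fd; rewrite !ltW.
- exact: rderiv_continuous fd.
by rewrite in_itv /= => cab E; rewrite -subr_ge0 E mulr_ge0 ?df0 ?subr_ge0.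
Qed.

End real_deriv.

(** * Differential calculus for matrix functions and the mean value inequality *)

Section matrix_deriv.
Context {R : realType} {n : nat}.
Local Notation M := 'M[R[i]]_n.
Implicit Types (D : set R) (F G : R -> M).

Definition mcont D F t := forall e : R, 0 < e ->
  exists2 dl, 0 < dl & forall u, D u -> `|u - t| < dl -> mnorm (F u - F t) <= e.

Lemma mderivW D D' F t d : D' `<=` D -> mderiv D F t d -> mderiv D' F t d.
Proof.
move=> sD Fd e /Fd[k k0 H]; exists k => // u /sD Du; exact: H.
Qed.

Lemma eq_mderiv D F G t d : (forall u, D u -> F u = G u) -> D t ->
  mderiv D F t d -> mderiv D G t d.
Proof.
move=> FG Dt Fd e /Fd[k k0 H]; exists k => // u Du; rewrite -!FG//; exact: H.
Qed.

(** Allows the rules below to be proved up to a constant factor, by rescaling e; [|C| + 1] serves as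
    a positive bound whatever the sign of C. *)
Lemma mderiv_scale D F t d (C : R) :
  (forall e, 0 < e -> exists2 dl, 0 < dl & forall u, D u -> `|u - t| < dl ->
    mnorm (F u - F t - (u - t)%:C%C *: d) <= C * (e * `|u - t|)) ->
  mderiv D F t d.
Proof.
move=> H e e0; pose C' := `|C| + 1.
have C0 : 0 < C' by rewrite ltr_wpDl.
have [k k0 {}H] := H (e / C') (divr_gt0 e0 C0).
exists k => // u Du ut; apply: le_trans (H u Du ut) _.
have q0 : 0 <= e / C' * `|u - t| by rewrite mulr_ge0// ltW// divr_gt0.
apply: (@le_trans _ _ (C' * (e / C' * `|u - t|))).
  by rewrite ler_wpM2r// /C'; have := ler_norm C; lra.
by rewrite mulrA [C' * _]mulrC divfK// gt_eqF.
Qed.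

Lemma mderiv_lipschitz D F t d : mderiv D F t d ->
  exists2 dl, 0 < dl & forall u, D u -> `|u - t| < dl ->
    mnorm (F u - F t) <= (mnorm d + 1) * `|u - t|.
Proof.
move=> /(_ _ ltr01)[k k0 H]; exists k => // u Du ut.
rewrite -[F u - F t](subrK ((u - t)%:C%C *: d)).
apply: le_trans (mnormD _ _) _; rewrite mnormZ.
by have := H u Du ut; lra.
Qed.

Lemma mderiv_cont D F t d : mderiv D F t d -> mcont D F t.
Proof.
move=> /mderiv_lipschitz[k k0 H] e e0.
have C0 : 0 < mnorm d + 1 by rewrite ltr_wpDl ?mnorm_ge0.
exists (Num.min k (e / (mnorm d + 1))); first by rewrite lt_min k0 divr_gt0.
move=> u Du; rewrite lt_min => /andP[/(H u Du) h].
by rewrite ltr_pdivlMr// => he; move: h he; lra.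
Qed.

Lemma mderiv_cst D (A : M) t : mderiv D (fun=> A) t 0.
Proof.
move=> e e0; exists 1 => // u _ _.
by rewrite subrr scaler0 subr0 mnorm0 mulr_ge0// ltW.
Qed.

Lemma mderiv_trmx D F t d : mderiv D F t d -> mderiv D (fun u => (F u)^T) t d^T.
Proof.
move=> Fd e /Fd[k k0 H]; exists k => // u Du ut.
by rewrite -!linearB -linearZ -linearB mnormT; exact: H.
Qed.

Lemma mderivD D F G t d d' : mderiv D F t d -> mderiv D G t d' ->
  mderiv D (fun u => F u + G u) t (d + d').
Proof.
move=> Fd Gd; apply: (@mderiv_scale _ _ _ _ 2) => e e0.
have [k1 k10 {}Fd] := Fd _ e0; have [k2 k20 {}Gd] := Gd _ e0.
exists (Num.min k1 k2); first by rewrite lt_min k10.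
move=> u Du; rewrite lt_min => /andP[/(Fd u Du) h1 /(Gd u Du) h2].
have -> : F u + G u - (F t + G t) - (u - t)%:C%C *: (d + d') =
    (F u - F t - (u - t)%:C%C *: d) + (G u - G t - (u - t)%:C%C *: d').
  by apply/matrixP => i j; rewrite !mxE; ring.
by apply: le_trans (mnormD _ _) _; move: h1 h2; lra.
Qed.

Lemma mderivM D F G t d d' : mderiv D F t d -> mderiv D G t d' ->
  mderiv D (fun u => F u *m G u) t (d *m G t + F t *m d').
Proof.
move=> Fd Gd.
have [k1 k10 Fl] := mderiv_lipschitz Fd; have [k2 k20 Gl] := mderiv_lipschitz Gd.
apply: (@mderiv_scale _ _ _ _
  (mnorm (G t) + mnorm (F t) + (mnorm d + 1) * (mnorm d' + 1))) => e e0.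
have [k3 k30 {}Fd] := Fd _ e0; have [k4 k40 {}Gd] := Gd _ e0.
(* The bound by e turns the quadratic term, of order [|u - t|] squared, into [e * |u - t|]. *)
exists (Num.min (Num.min (Num.min k1 k2) (Num.min k3 k4)) e).
  by rewrite !lt_min k10 k20 k30 k40.
move=> u Du; rewrite !lt_min => /andP[/andP[/andP[/(Fl u Du) h1 /(Gl u Du) h2]]].
move=> /andP[/(Fd u Du) h3 /(Gd u Du) h4] he.
have -> : F u *m G u - F t *m G t - (u - t)%:C%C *: (d *m G t + F t *m d') =
    (F u - F t - (u - t)%:C%C *: d) *m G t +
    F t *m (G u - G t - (u - t)%:C%C *: d') + (F u - F t) *m (G u - G t).
  rewrite !(mulmxBl, mulmxBr) -scalemxAl -scalemxAr scalerDr.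
  move: (F u *m G u) (F t *m G t) (F u *m G t) (F t *m G u) => A B C E.
  move: (_ *: (d *m _)) (_ *: (_ *m d')) => X Y.
  by apply/matrixP => i j; rewrite !mxE; ring.
apply: le_trans (mnormD _ _) _.
have p1 := le_trans (mnormM _ (G t)) (ler_wpM2r (mnorm_ge0 (G t)) h3).
have p2 := le_trans (mnormM (F t) _) (ler_wpM2l (mnorm_ge0 (F t)) h4).
have p3 := le_trans (mnormM _ _) (ler_pM (mnorm_ge0 _) (mnorm_ge0 _) h1 h2).
have p4 : `|u - t| * `|u - t| <= e * `|u - t| by rewrite ler_wpM2r// ltW.
have p5 := ler_wpM2l (mulr_ge0 (addr_ge0 (mnorm_ge0 d) ler01)
                       (addr_ge0 (mnorm_ge0 d') ler01)) p4.
have p6 := mnormD ((F u - F t - (u - t)%:C%C *: d) *m G t)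
    (F t *m (G u - G t - (u - t)%:C%C *: d')).
by move: p1 p2 p3 p5 p6; lra.
Qed.

Lemma mderivZ D F t d (c : R) : mderiv D F t d ->
  mderiv D (fun u => c%:C%C *: F u) t (c%:C%C *: d).
Proof.
move=> Fd; apply: (@mderiv_scale _ _ _ _ `|c|) => e e0.
have [k k0 {}Fd] := Fd _ e0; exists k => // u Du /(Fd u Du) h.
by rewrite scalerA [(u - t)%:C%C * _]mulrC -scalerA -!scalerBr mnormZ ler_wpM2l.
Qed.

Lemma mderivB D F G t d d' : mderiv D F t d -> mderiv D G t d' ->
  mderiv D (fun u => F u - G u) t (d - d').
Proof.
move=> Fd /(@mderivZ _ _ _ _ (-1)) Gd.
have NZ (A : M) : - A = (-1)%:C%C *: A by rewrite rmorphN1 scaleN1r.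
rewrite (NZ d') (_ : (fun u => F u - G u) = fun u => F u + (-1)%:C%C *: G u).
  exact: mderivD.
by apply/funext => u; rewrite -NZ.
Qed.

(** Here X and Y are the inverses of F(u) and F(t), and Dl = F(u) - F(t). Using X = Y - X Dl Y twice
    expands X to second order in Dl: a quadratic term remains, plus the linear remainder of F
    between two copies of Y. *)
Lemma invmx_increment (X Y Dl d : M) (c : R[i]) : X *m Dl *m Y = Y - X ->
  X - Y - c *: - (Y *m d *m Y) =
  X *m Dl *m Y *m Dl *m Y - Y *m (Dl - c *: d) *m Y.
Proof.
move=> XDY; rewrite scalerN opprK XDY mulmxBr !mulmxBl XDY.
rewrite -scalemxAr -scalemxAl.
move: (Y *m Dl *m Y) (c *: _) => A B.
by apply/matrixP => i j; rewrite !mxE; ring.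
Qed.

Lemma mderivV D F t d : D t -> (forall u, D u -> F u \in unitmx) ->
  mderiv D F t d ->
  mderiv D (fun u => invmx (F u)) t (- (invmx (F t) *m d *m invmx (F t))).
Proof.
move=> Dt Fu Fd; have [k1 k10 Fl] := mderiv_lipschitz Fd.
set Y := invmx (F t); set L := mnorm d + 1; set y := mnorm Y.
have L0 : 0 < L by rewrite /L ltr_wpDl ?mnorm_ge0.
have y0 : 0 <= y := mnorm_ge0 Y.
have Ly0 : 0 < 2 * L * (y + 1) by rewrite !mulr_gt0// ltr_wpDl.
apply: (@mderiv_scale _ _ _ _ (2 * y * L * y * L * y + y * y)) => e e0.
have [k2 k20 {}Fd] := Fd _ e0.
(* The third bound forces L |u - t| y <= 1/2, which controls the inverse near t; the bound by e
   absorbs the quadratic term. *)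
exists (Num.min (Num.min k1 k2) (Num.min (2 * L * (y + 1))^-1 e)).
  by rewrite !lt_min k10 k20 invr_gt0 Ly0.
move=> u Du; rewrite !lt_min => /andP[/andP[/(Fl u Du) h1 /(Fd u Du) h2]].
rewrite -[(_)^-1]mul1r ltr_pdivlMr// => /andP[h3 he].
set X := invmx (F u); set Dl := F u - F t in h1 h2 *.
set r := Dl - _ in h2; set h := `|u - t| in h1 h2 h3 he *.
have h0 : 0 <= h by exact: normr_ge0.
have XDY : X *m Dl *m Y = Y - X.
  by rewrite /Dl mulmxBr mulmxBl (mulVmx (Fu _ Du)) mul1mx (mulmxK (Fu _ Dt)).
(* Bootstrap: X = Y - X Dl Y gives |X| <= |Y| + |X| / 2. *)
have xle : mnorm X <= 2 * y.
  have : mnorm X <= y + mnorm X * (L * h) * y.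
    rewrite -[X in mnorm X <= _](subKr Y) -XDY.
    apply: le_trans (mnormB _ _) _; rewrite lerD2l.
    apply: le_trans (mnormM _ _) _; rewrite ler_wpM2r//.
    by apply: le_trans (mnormM _ _) _; rewrite ler_wpM2l// mnorm_ge0.
  have x0 := mnorm_ge0 X.
  have : mnorm X * (L * h) * y <= mnorm X / 2.
    rewrite -mulrA ler_wpM2l//.
    have : 0 <= L * h by rewrite mulr_ge0// ltW.
    by move: h3; lra.
  by lra.
rewrite (invmx_increment d _ XDY) -/r.
have q1 : mnorm (Y *m r *m Y) <= y * (e * h) * y.
  apply: le_trans (mnormM _ _) _; rewrite ler_wpM2r//.
  by apply: le_trans (mnormM _ _) _; rewrite ler_wpM2l.
have q2 : mnorm (X *m Dl *m Y *m Dl *m Y) <= 2 * y * (L * h) * y * (L * h) * y.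
  apply: le_trans (mnormM _ _) _; rewrite ler_wpM2r//.
  apply: le_trans (mnormM _ _) _; apply: ler_pM; rewrite ?mnorm_ge0//.
  apply: le_trans (mnormM _ _) _; rewrite ler_wpM2r//.
  by apply: le_trans (mnormM _ _) _; apply: ler_pM; rewrite ?mnorm_ge0.
apply: le_trans (mnormB _ _) (le_trans (lerD q2 q1) _).
have p4 : h * h <= e * h by rewrite ler_wpM2r// ltW.
have c0 : 0 <= 2 * y * L * y * L * y by rewrite !mulr_ge0// ltW.
have -> : 2 * y * (L * h) * y * (L * h) * y = 2 * y * L * y * L * y * (h * h) by ring.
have -> : y * (e * h) * y = y * y * (e * h) by ring.
by rewrite [leRHS]mulrDl lerD2r; exact: ler_wpM2l.
Qed.

Lemma mderiv_support D F t d (S : M) :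
  mderiv D F t d -> rderiv D (support_fun S \o F) t (support_fun S d).
Proof.
move=> Fd e /Fd[k k0 H]; exists k => // u Du ut /=.
rewrite -support_funZ -!(support_funN, support_funD).
by apply: le_trans (support_fun_le _ _) _; exact: H.
Qed.

(** The norming functional of F(b) - F(a) recovers the norm of that increment, and sends dF to at
    most |dF| <= dg; so g minus the functional of F is nondecreasing. A general majorant g
    accommodates both linear and exponential bounds. *)
Lemma mderiv_norm_le (a b : R) F dF g dg : a <= b ->
  (forall t, a <= t <= b -> mderiv (seg a b) F t (dF t)) ->
  (forall t, a <= t <= b -> rderiv (seg a b) g t (dg t)) ->
  (forall t, a <= t <= b -> mnorm (dF t) <= dg t) ->
  mnorm (F b - F a) <= g b - g a.
Proof.
move=> ab Fd gd Fg; set S := F b - F a; pose f := support_fun S \o F.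
have := @rderiv_ge0_le _ a b (g \+ \- f)
  (fun t => dg t + - support_fun S (dF t)) ab.
move=> H; have : g a - f a <= g b - f b.
  apply: H => t tab.
    by apply: rderivD (gd t tab) _; apply: rderivN; exact: mderiv_support (Fd t tab).
  rewrite subr_ge0; apply: le_trans (Fg t tab).
  by apply: le_trans (ler_norm _) (support_fun_le _ _).
have -> : mnorm S = f b - f a.
  by rewrite -support_funS {2}/S support_funD support_funN.
by lra.
Qed.

Lemma mderiv0_cst (a b : R) F : a <= b ->
  (forall t, a <= t <= b -> mderiv (seg a b) F t 0) -> F b = F a.
Proof.
move=> ab Fd; apply/eqP; rewrite -subr_eq0; apply/eqP/mnorm_le0_eq0.
have := @mderiv_norm_le a b F (fun=> 0) (fun=> 0) (fun=> 0) ab Fd.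
rewrite subrr; apply => [t _ e e0|t _]; last by rewrite mnorm0.
by exists 1 => // u _ _; rewrite mulr0 !subr0 normr0 mulr_ge0// ltW.
Qed.

End matrix_deriv.

(** * Antiderivatives of continuous real functions on a segment *)

Section antiderivative.
Context {R : realType}.

Definition rcont (D : set R) (f : R -> R) t := forall e : R, 0 < e ->
  exists2 dl, 0 < dl & forall u, D u -> `|u - t| < dl -> `|f u - f t| <= e.

Lemma rcont_within (a b : R) f :
  (forall t, a <= t <= b -> rcont (seg a b) f t) ->
  {within `[a, b], continuous f}.
Proof.
move=> fc; apply/subspace_continuousP => t /= tab.
apply/cvgrPdist_le => e e0; apply/near_withinP.
have [k k0 {}fc] := fc t tab _ e0.
exists k => // u /= uab; rewrite /ball /= distrC => ut.
by rewrite distrC; exact: fc.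
Qed.

Lemma rantideriv (a b : R) f : a <= b ->
  (forall t, a <= t <= b -> rcont (seg a b) f t) ->
  exists F, forall t, a <= t <= b -> rderiv (seg a b) F t (f t).
Proof.
(* Clamping to [a, b] extends f continuously to the whole line, so that the fundamental theorem
   applies on [a - 1, b + 1], where a and b are interior points. *)
move=> ab fc; pose cl x := Num.max a (Num.min b x).
have clab x : a <= cl x <= b.
  by rewrite /cl le_max lexx ge_max ab ge_min lexx.
have clE x : a <= x <= b -> cl x = x.
  by move=> /andP[ax xb]; rewrite /cl (min_idPr xb) (max_idPr ax).
have cllip x y : `|cl x - cl y| <= `|x - y|.
  rewrite /cl; case: (leP b x) => bx; case: (leP b y) => yb;
  rewrite ?(max_idPr ab).
  - by rewrite subrr normr0.
  - case: (leP a y) => ay; rewrite !ger0_norm; lra.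
  - case: (leP a x) => ax; rewrite !ler0_norm; lra.
  - case: (leP a x) => ax; case: (leP a y) => ay => //;
    rewrite ?subrr ?normr0//.
    + by rewrite !ger0_norm; lra.
    + by rewrite !ler0_norm; lra.
pose g := f \o cl.
have gc : continuous g.
  move=> x; apply/cvgrPdist_le => e e0; apply/nbhs_ballP.
  have [k /= k0 {}fc] := fc (cl x) (clab x) _ e0.
  exists k => // y; rewrite /ball /= => xy.
  rewrite distrC; apply: fc; first exact: clab.
  by apply: le_lt_trans (cllip _ _) _; rewrite distrC.
pose mu := @lebesgue_measure R.
exists (fun x => \int[mu]_(y in `[a - 1, x]) g y) => t tab.
have gi : mu.-integrable `[a - 1, b + 1] (EFin \o g).
  apply: continuous_compact_integrable; first exact: segment_compact.
  exact: continuous_subspaceT.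
have [|||df fE] := @continuous_FTC1_closed R g (a - 1) t (b + 1) _ gi.
- by case/andP: tab; lra.
- by case/andP: tab; lra.
- exact: gc.
apply: is_derive_rderiv; apply: DeriveDef; first exact: df.
by rewrite -derive1E fE /g /= clE.
Qed.

End antiderivative.

(** * Matrix antiderivatives, and maxima of norms on a segment *)

Section matrix_antiderivative.
Context {R : realType} {n : nat}.
Local Notation M := 'M[R[i]]_n.

Lemma mderiv_entries (D : set R) (F : R -> M) t (d : M) :
  (forall i j, rderiv D (fun u => complex.Re (F u i j)) t (complex.Re (d i j))) ->
  (forall i j, rderiv D (fun u => complex.Im (F u i j)) t (complex.Im (d i j))) ->
  mderiv D F t d.
Proof.
move=> Fre Fim; apply: (@mderiv_scale _ _ _ _ _ _ (2 * (n * n)%:R)) => e e0.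
(* Passing through a filter yields one radius for the finitely many entries at once. *)
have : \forall u \near within D (nbhs t), forall ij : 'I_n * 'I_n,
    cnorm ((F u - F t - (u - t)%:C%C *: d) ij.1 ij.2) <= 2 * (e * `|u - t|).
  apply: filter_forall => -[i j] /=.
  have [k1 k10 {}Fre] := Fre i j _ e0; have [k2 k20 {}Fim] := Fim i j _ e0.
  apply/near_withinP; exists (Num.min k1 k2); first by rewrite lt_min k10.
  move=> u Du; rewrite /ball /= lt_min distrC => /andP[/(Fre u Du) + /(Fim u Du)].
  rewrite !mxE; case: (F u i j) (F t i j) (d i j) => [p q] [p' q'] [p'' q''] /=.
  by rewrite /cnorm /= !mul0r subr0 addr0; lra.
move=> /near_withinP[k k0 H]; exists k => // u Du ut.
have {}H i j := H u Du _ (i, j).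
apply: (@le_trans _ _ (\sum_(i < n) \sum_(j < n) 2 * (e * `|u - t|))).
  apply: ler_sum => i _; apply: ler_sum => j _; apply: H.
  by rewrite /ball /= distrC.
by rewrite !sumr_const !card_ord -mulrnA -mulr_natr; lra.
Qed.

Lemma mantideriv (a b : R) (f : R -> M) (c : M) : a <= b ->
  (forall t, a <= t <= b -> mcont (seg a b) f t) ->
  exists F, F a = c /\ forall t, a <= t <= b -> mderiv (seg a b) F t (f t).
Proof.
move=> ab fc.
have fle t u i j : `|complex.Re (f u i j) - complex.Re (f t i j)| <= mnorm (f u - f t)
   /\ `|complex.Im (f u i j) - complex.Im (f t i j)| <= mnorm (f u - f t).
  have := mnorm_entry (f u - f t) i j; rewrite !mxE.
  case: (f u i j) (f t i j) => [p q] [p' q']; rewrite /cnorm /=.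
  by have := normr_ge0 (p - p'); have := normr_ge0 (q - q'); split; lra.
have /choice[Fr FrP] (ij : 'I_n * 'I_n) : exists F, forall t, a <= t <= b ->
    rderiv (seg a b) F t (complex.Re (f t ij.1 ij.2)).
  apply: rantideriv => // t tab e e0; have [k k0 {}fc] := fc t tab _ e0.
  exists k => // u Du ut; apply: le_trans (fc u Du ut).
  exact: (fle _ _ _ _).1.
have /choice[Fi FiP] (ij : 'I_n * 'I_n) : exists F, forall t, a <= t <= b ->
    rderiv (seg a b) F t (complex.Im (f t ij.1 ij.2)).
  apply: rantideriv => // t tab e e0; have [k k0 {}fc] := fc t tab _ e0.
  exists k => // u Du ut; apply: le_trans (fc u Du ut).
  exact: (fle _ _ _ _).2.
pose F u : M := \matrix_(i, j) Complex (Fr (i, j) u) (Fi (i, j) u).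
exists (fun u => F u + (c - F a)); split; first by rewrite addrCA subrr addr0.
move=> t tab; rewrite -[f t]addr0; apply: mderivD; last exact: mderiv_cst.
apply: mderiv_entries => i j.
  rewrite (_ : (fun u => _) = Fr (i, j)); last by apply/funext => u; rewrite mxE.
  exact: (FrP (i, j)).
rewrite (_ : (fun u => _) = Fi (i, j)); last by apply/funext => u; rewrite mxE.
exact: (FiP (i, j)).
Qed.

Lemma mcont_max (a b : R) (f : R -> M) : a <= b ->
  (forall t, a <= t <= b -> mcont (seg a b) f t) ->
  exists2 c, a <= c <= b & forall t, a <= t <= b -> mnorm (f t) <= mnorm (f c).
Proof.
move=> ab fc.
have : {within `[a, b], continuous (mnorm \o f)}.
  apply: rcont_within => t tab e e0; have [k k0 {}fc] := fc t tab _ e0.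
  exists k => // u Du ut; apply: le_trans (fc u Du ut) => /=.
  rewrite ler_norml; apply/andP; split.
    have := mnormD (f t - f u) (f u); rewrite subrK mnormBC; lra.
  by have := mnormD (f u - f t) (f t); rewrite subrK; lra.
move=> /(EVT_max ab)[c cab cP]; exists c; first by move: cab; rewrite in_itv.
by move=> t tab; have := cP t; rewrite in_itv /=; exact.
Qed.

Lemma mcont_bounded (a b : R) (f : R -> M) : a <= b ->
  (forall t, a <= t <= b -> mcont (seg a b) f t) ->
  exists2 K, 0 < K & forall t, a <= t <= b -> mnorm (f t) <= K.
Proof.
move=> ab /(mcont_max ab)[c _ cP]; exists (mnorm (f c) + 1).
  by rewrite ltr_wpDl// mnorm_ge0.
by move=> t /cP; lra.
Qed.

End matrix_antiderivative.

(** * Sequences with geometrically small increments *)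

Section geometric.
Context {R : realType}.

Lemma geometric_le0 (C x : R) : (forall k, x <= C / 2 ^+ k) -> x <= 0.
Proof.
move=> H; rewrite leNgt; apply/negP => x0.
have C0 : 0 <= C / x.
  by rewrite divr_ge0 ?(ltW x0)//; have := H 0%N; rewrite expr0 divr1; lra.
have := archi_boundP C0; set k := Num.Def.archi_bound _ => Ck.
have kk : k%:R < 2 ^+ k :> R by rewrite -natrX ltr_nat ltn_expl.
have := H k; rewrite leNgt => /negP; apply.
rewrite ltr_pdivrMr ?exprn_gt0// mulrC -ltr_pdivrMr//.
exact: lt_trans Ck kk.
Qed.

(** Nested intervals: 2C / 2^k is the sum of the bounds on all increments from k on, so u - 2C / 2^k
    increases, u + 2C / 2^k decreases, and the supremum of the former lies in every interval. *)
Lemma geometric_limit (C : R) (u : nat -> R) :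
  (forall k, `|u k.+1 - u k| <= C / 2 ^+ k) ->
  exists l, forall k, `|u k - l| <= 2 * C / 2 ^+ k.
Proof.
move=> uC.
have half k : C / 2 ^+ k.+1 = C / 2 ^+ k / 2 by rewrite exprS invfM mulrA mulrAC.
have C0 : 0 <= C by have := uC 0%N; rewrite expr0 divr1; apply: le_trans.
have Ck0 k : 0 <= C / 2 ^+ k by rewrite divr_ge0// exprn_ge0.
pose v k := u k - 2 * (C / 2 ^+ k); pose w k := u k + 2 * (C / 2 ^+ k).
have vS k : v k <= v k.+1.
  by have := uC k; rewrite ler_norml /v half => /andP[]; lra.
have wS k : w k.+1 <= w k.
  by have := uC k; rewrite ler_norml /w half => /andP[]; lra.
have vh : {homo v : i j / (i <= j)%N >-> i <= j} by exact: homo_leq le_trans vS.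
have wh i j : (i <= j)%N -> w j <= w i.
  by move=> /subnK<-; elim: (j - i)%N => // m; apply: le_trans; rewrite addSn.
have vw i j : v i <= w j.
  apply: (@le_trans _ _ (v (maxn i j))); first exact/vh/leq_maxl.
  apply: (@le_trans _ _ (w (maxn i j))); last exact/wh/leq_maxr.
  by rewrite /v /w; have := Ck0 (maxn i j); lra.
exists (sup (range v)) => k.
have h1 : v k <= sup (range v).
  apply: ub_le_sup; last by exists k.
  by exists (w 0%N) => _ [i _ <-].
have h2 : sup (range v) <= w k.
  by apply: ge_sup; [exists (v 0%N), 0%N|move=> _ [i _ <-]].
by rewrite ler_norml -mulrA; move: h1 h2; rewrite /v /w => ? ?; apply/andP; split; lra.
Qed.

(** Real and imaginary parts each converge with error 2C / 2^k, hence 4C for each of the n * n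
    entries. *)
Lemma geometric_mlimit (n : nat) (C : R) (U : nat -> 'M[R[i]]_n) :
  (forall k, mnorm (U k.+1 - U k) <= C / 2 ^+ k) ->
  exists L, forall k, mnorm (U k - L) <= (n * n)%:R * (4 * C) / 2 ^+ k.
Proof.
move=> UC.
have Ule k i j : `|complex.Re (U k.+1 i j) - complex.Re (U k i j)| <= C / 2 ^+ k /\
    `|complex.Im (U k.+1 i j) - complex.Im (U k i j)| <= C / 2 ^+ k.
  have := le_trans (mnorm_entry (U k.+1 - U k) i j) (UC k); rewrite !mxE.
  case: (U k.+1 i j) (U k i j) => [p q] [p' q']; rewrite /cnorm /=.
  by have := normr_ge0 (p - p'); have := normr_ge0 (q - q'); split; lra.
have /choice[Lr LrP] (ij : 'I_n * 'I_n) : exists l, forall k,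
    `|complex.Re (U k ij.1 ij.2) - l| <= 2 * C / 2 ^+ k.
  by apply: geometric_limit => k; exact: (Ule _ _ _).1.
have /choice[Li LiP] (ij : 'I_n * 'I_n) : exists l, forall k,
    `|complex.Im (U k ij.1 ij.2) - l| <= 2 * C / 2 ^+ k.
  by apply: geometric_limit => k; exact: (Ule _ _ _).2.
exists (\matrix_(i, j) Complex (Lr (i, j)) (Li (i, j))) => k.
apply: (@le_trans _ _ (\sum_(i < n) \sum_(j < n) 4 * C / 2 ^+ k)).
  apply: ler_sum => i _; apply: ler_sum => j _; rewrite !mxE.
  have := LrP (i, j) k; have := LiP (i, j) k => /=.
  by case: (U k i j) => p q; rewrite /cnorm /=; lra.
by rewrite !sumr_const !card_ord -mulrnA -mulr_natr; lra.
Qed.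

End geometric.

(** * Existence for linear systems by Picard iteration *)

Section linear_ode.
Context {R : realType} {n : nat}.
Local Notation M := 'M[R[i]]_n.

Lemma mcontM (D : set R) (F G : R -> M) t :
  mcont D F t -> mcont D G t -> mcont D (fun u => F u *m G u) t.
Proof.
move=> Fc Gc e e0; pose C := mnorm (F t) + mnorm (G t) + 1.
have C0 : 0 < C by rewrite /C ltr_wpDl// addr_ge0// mnorm_ge0.
(* The bound by 1 makes the product of the two increments at most e'. *)
pose e' := Num.min 1 (e / C).
have e'0 : 0 < e' by rewrite lt_min ltr01 divr_gt0.
have [k1 k10 {}Fc] := Fc _ e'0; have [k2 k20 {}Gc] := Gc _ e'0.
exists (Num.min k1 k2); first by rewrite lt_min k10.
move=> u Du; rewrite lt_min => /andP[/(Fc u Du) h1 /(Gc u Du) h2].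
have -> : F u *m G u - F t *m G t =
    (F u - F t) *m (G u - G t) + F t *m (G u - G t) + (F u - F t) *m G t.
  rewrite !(mulmxBl, mulmxBr).
  move: (F u *m G u) (F t *m G t) (F u *m G t) (F t *m G u) => P Q S T.
  by apply/matrixP => i j; rewrite !mxE; ring.
have e1 : e' <= 1 by rewrite ge_min lexx.
have eC : e' * C <= e.
  by rewrite -ler_pdivlMr// ge_min lexx orbT.
have p1 := le_trans (mnormM _ _) (ler_pM (mnorm_ge0 _) (mnorm_ge0 _) h1 (le_trans h2 e1)).
have p2 := le_trans (mnormM (F t) _) (ler_wpM2l (mnorm_ge0 (F t)) h2).
have p3 := le_trans (mnormM _ (G t)) (ler_wpM2r (mnorm_ge0 (G t)) h1).
apply: le_trans (mnormD _ _) _.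
have p4 := mnormD ((F u - F t) *m (G u - G t)) (F t *m (G u - G t)).
by move: p1 p2 p3 p4 eC; rewrite /C; lra.
Qed.

Lemma is_derive_expR_scale (c L a t : R) :
  is_derive t 1 (fun x => c * expR (L * (x - a))) (c * (L * expR (L * (t - a)))).
Proof.
have h : is_derive t 1 (fun x : R => L * (x - a)) L.
  by apply: is_derive_eq; rewrite subr0 [LHS]mulr1.
have h2 : is_derive t 1 (expR \o (fun x : R => L * (x - a)))
    (expR (L * (t - a)) * L) by exact: is_derive1_comp.
have : is_derive t 1 (c \*: (expR \o (fun x : R => L * (x - a))))
    (c *: (expR (L * (t - a)) * L)).
  exact: is_deriveZ.
by rewrite [_ * L]mulrC.
Qed.

Lemma linear_ode_exists (a b : R) (B : R -> M) : a <= b ->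
  (forall t, a <= t <= b -> mcont (seg a b) B t) ->
  exists F, F a = 1%:M /\
    forall t, a <= t <= b -> mderiv (seg a b) F t (B t *m F t).
Proof.
move=> ab Bc; have [K K0 BK] := mcont_bounded ab Bc.
pose cont (F : R -> M) := forall t, a <= t <= b -> mcont (seg a b) F t.
(* [S] is the Picard map, sending F to the antiderivative of B F with value 1 at a. On discontinuous
   F its value is arbitrary. *)
have /choice[S SP] (F : R -> M) : exists G, cont F -> G a = 1%:M /\
    forall t, a <= t <= b -> mderiv (seg a b) G t (B t *m F t).
  have [Fc|nFc] := pselect (cont F); last by exists F.
  have [|G GP] := @mantideriv R n a b (fun t => B t *m F t) 1%:M ab.
    by move=> t tab; exact: mcontM (Bc t tab) (Fc t tab).
  by exists G.
have Sc F : cont F -> cont (S F).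
  by move=> Fc t tab; exact: mderiv_cont ((SP F Fc).2 t tab).
pose U k := iter k S (fun=> 1%:M).
have Uc k : cont (U k).
  elim: k => [t _|k IH]; last exact: Sc.
  exact: mderiv_cont (mderiv_cst _ _ _).
have Ua k : U k a = 1%:M by case: k => // k; exact: (SP _ (Uc k)).1.
have subab x : a <= x <= b -> seg a x `<=` seg a b.
  by move=> /andP[_ xb] u /= /andP[-> ux]; exact: le_trans ux xb.
(* The Lipschitz estimate for the Picard map, in differential form: a majorant of K |F - G| is
   integrated instead of the norm itself. *)
have SB F G x g dg : cont F -> cont G -> a <= x <= b ->
    (forall t, a <= t <= x -> rderiv (seg a x) g t (dg t)) ->
    (forall t, a <= t <= x -> K * mnorm (F t - G t) <= dg t) ->
    mnorm (S F x - S G x) <= g x - g a.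
  move=> Fc Gc xab gd dgP; have /andP[ax xb] := xab.
  have [SFa SFd] := SP F Fc; have [SGa SGd] := SP G Gc.
  have := @mderiv_norm_le R n a x (fun u => S F u - S G u)
    (fun t => B t *m (F t - G t)) g dg ax.
  rewrite SFa SGa subrr subr0; apply => // t tax.
    have tab : a <= t <= b by exact: (subab x xab).
    rewrite mulmxBr; apply: (mderivW (subab x xab)).
    exact: mderivB (SFd t tab) (SGd t tab).
  apply: le_trans (mnormM _ _) _; apply: le_trans (dgP t tax).
  by rewrite ler_wpM2r ?mnorm_ge0// BK//; exact: (subab x xab).
have [c c0 cP] : exists2 c, 0 < c & forall t,
    a <= t <= b -> mnorm (U 1%N t - U 0%N t) <= c.
  have [c1 c10 c1P] := mcont_bounded ab (Uc 0%N).
  have [c2 c20 c2P] := mcont_bounded ab (Uc 1%N).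
  exists (c2 + c1); first exact: addr_gt0.
  move=> t tab; apply: le_trans (mnormB _ _) _.
  exact: lerD (c2P t tab) (c1P t tab).
(* With this rate, K times c / 2^k * exp(L(t - a)) is exactly the derivative of c / 2^(k+1) *
   exp(L(t - a)), so each iteration gains a factor 1/2. *)
pose L := 2 * K.
have UU k x : a <= x <= b ->
    mnorm (U k.+1 x - U k x) <= c / 2 ^+ k * expR (L * (x - a)).
  elim: k x => [|k IH] x xab.
    rewrite expr0 divr1; apply: le_trans (cP x xab) _.
    apply: ler_peMr; first exact: ltW.
    rewrite -expR0 ler_expR; apply: mulr_ge0; first by rewrite mulr_ge0// ltW.
    by rewrite subr_ge0; case/andP: xab.
  have q0 : 0 <= c / 2 ^+ k.+1 by rewrite divr_ge0// ?ltW// exprn_gt0.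
  apply: (@le_trans _ _ (c / 2 ^+ k.+1 * expR (L * (x - a)) -
     c / 2 ^+ k.+1 * expR (L * (a - a)))); last first.
    by rewrite gerBl mulr_ge0// expR_ge0.
  apply: (SB (U k.+1) (U k) x (fun x => c / 2 ^+ k.+1 * expR (L * (x - a)))
    (fun t => c / 2 ^+ k.+1 * (L * expR (L * (t - a))))) => // t tax.
    exact/is_derive_rderiv/is_derive_expR_scale.
  have tab : a <= t <= b by exact: (subab x xab).
  apply: le_trans (ler_wpM2l (ltW K0) (IH t tab)) _.
  have -> : c / 2 ^+ k.+1 = c / 2 ^+ k / 2 by rewrite exprS invfM mulrA mulrAC.
  by rewrite /L; lra.
pose E := expR (L * (b - a)).
have UE k x : a <= x <= b -> mnorm (U k.+1 x - U k x) <= c * E / 2 ^+ k.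
  move=> xab; apply: le_trans (UU k x xab) _.
  rewrite mulrAC ler_pM2r ?invr_gt0 ?exprn_gt0// ler_pM2l// ler_expR.
  apply: ler_wpM2l; first by rewrite mulr_ge0// ltW.
  by rewrite lerB//; case/andP: xab.
pose C := (n * n)%:R * (4 * (c * E)).
have C0 : 0 <= C by rewrite !mulr_ge0 ?(ltW c0) ?expR_ge0.
have /choice[F FP] (x : R) : exists V, a <= x <= b ->
    forall k, mnorm (U k x - V) <= C / 2 ^+ k.
  have [xab|nxab] := boolP (a <= x <= b); last by exists 0.
  have [V VP] := @geometric_mlimit R n (c * E) (fun k => U k x) (fun k => UE k x xab).
  by exists V.
(* Continuity of a uniform limit: [U k] is within e/4 of F at both points and varies by at most
   e/2. *)
have Fc : cont F.
  move=> t tab e e0.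
  have [k kP] : exists k, 2 * (C / 2 ^+ k) < e / 2.
    apply: contrapT => /forallNP nk.
    have : e / 2 <= 0.
      apply: (@geometric_le0 R (2 * C)) => k.
      by have /negP := nk k; rewrite -leNgt mulrA.
    by lra.
  have e20 : 0 < e / 2 by rewrite divr_gt0.
  have [dl dl0 H] := Uc k t tab _ e20; exists dl => // u uab ut.
  have := H u uab ut; have := FP u uab k; have := FP t tab k.
  have -> : F u - F t = (U k u - U k t) - (U k u - F u) + (U k t - F t).
    by apply/matrixP => i j; rewrite !mxE; ring.
  have := mnormD ((U k u - U k t) - (U k u - F u)) (U k t - F t).
  have := mnormB (U k u - U k t) (U k u - F u).
  by move: kP; lra.
have [SFa SFd] := SP F Fc.
have SFE x : a <= x <= b -> S F x = F x.
  move=> xab; apply/eqP; rewrite -subr_eq0; apply/eqP/mnorm_le0_eq0.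
  (* The first term bounds the distance from S F to S (U k) = U (k+1), the second the distance from
     U (k+1) to F, both up to 1 / 2^k. *)
  apply: (@geometric_le0 R (K * C * (x - a) + C)) => k.
  have h1 : mnorm (S F x - U k.+1 x) <= K * (C / 2 ^+ k) * x - K * (C / 2 ^+ k) * a.
    apply: (SB F (U k) x ( *%R (K * (C / 2 ^+ k))) (fun=> K * (C / 2 ^+ k))) => //.
      by move=> t _; exact: rderiv_linear.
    move=> t tax; apply: ler_wpM2l; first exact: ltW.
    by rewrite mnormBC; apply: FP; exact: (subab x xab).
  have h2 := FP x xab k.+1.
  have h3 : C / 2 ^+ k.+1 <= C / 2 ^+ k.
    by rewrite ler_wpM2l// lef_pV2 ?posrE ?exprn_gt0// exprS ler_peMl ?exprn_ge0// ler1n.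
  rewrite -[S F x](subrK (U k.+1 x)) -addrA.
  apply: le_trans (mnormD _ _) _.
  by rewrite mulrDl; move: h1 h2 h3; lra.
exists (S F); split; first exact: SFa.
by move=> t tab; rewrite (SFE t tab); exact: (SFd t tab).
Qed.

End linear_ode.

(** * Invertibility, uniqueness, and the product integral as a flow *)

Section product_integral.
Context {R : realType} {n : nat}.
Local Notation M := 'M[R[i]]_n.

Lemma seg_subset (a b x y : R) : a <= x -> y <= b -> seg x y `<=` seg a b.
Proof.
by move=> ax yb u /= /andP[xu uy]; rewrite (le_trans ax xu) (le_trans uy yb).
Qed.

Lemma linear_ode_unit (a b : R) (B F : R -> M) :
  (forall t, a <= t <= b -> mcont (seg a b) B t) -> F a = 1%:M ->
  (forall t, a <= t <= b -> mderiv (seg a b) F t (B t *m F t)) ->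
  forall t, a <= t <= b -> F t \in unitmx.
Proof.
move=> Bc Fa Fd t tab; have /andP[at_ tb] := tab.
(* Transposition turns the adjoint equation, with coefficient on the right, into one covered by the
   existence lemma. A left inverse suffices for square matrices. *)
have [|H [Ha Hd]] := @linear_ode_exists R n a b (fun u => (- B u)^T) (le_trans at_ tb).
  move=> u uab e e0; have [k k0 {}Bc] := Bc u uab _ e0; exists k => // v vab vu.
  by rewrite -linearB mnormT -opprD mnormN; exact: Bc.
have sub := seg_subset (lexx a) tb.
suff /mulmx1_unit[] : (H t)^T *m F t = 1%:M by [].
rewrite (@mderiv0_cst R n a t (fun u => (H u)^T *m F u) at_).
  by rewrite Ha Fa trmx1 mul1mx.
move=> u uat; have uab := sub u uat.
have := mderivM (mderiv_trmx (Hd u uab)) (Fd u uab).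
rewrite trmx_mul trmxK mulmxN mulNmx mulmxA addNr; exact: mderivW.
Qed.

(** In the derivative of F^-1 H the terms - F^-1 B H and F^-1 B H cancel; invertibility of F takes
    the place of a Gronwall estimate. *)
Lemma linear_ode_unique (a b : R) (B F H : R -> M) : a <= b ->
  F a = H a -> (forall t, a <= t <= b -> F t \in unitmx) ->
  (forall t, a <= t <= b -> mderiv (seg a b) F t (B t *m F t)) ->
  (forall t, a <= t <= b -> mderiv (seg a b) H t (B t *m H t)) -> H b = F b.
Proof.
move=> ab FH Fu Fd Hd.
have : invmx (F b) *m H b = invmx (F a) *m H a.
  apply: (@mderiv0_cst R n a b (fun u => invmx (F u) *m H u) ab) => t tab.
  have := mderivM (mderivV tab Fu (Fd t tab)) (Hd t tab).
  rewrite (_ : _ + _ = 0)// mulNmx !mulmxA -[invmx (F t) *m B t *m F t *m _]mulmxA.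
  by rewrite mulmxV ?Fu// mulmx1 addNr.
have aa : a <= a <= b by rewrite lexx.
rewrite -FH mulVmx ?Fu// => /(congr1 (mulmx (F b))).
by rewrite mulmxA mulmxV ?Fu ?lexx ?ab// mul1mx mulmx1.
Qed.

Lemma prodint_solP (B : R -> M) (a b : R) F : prodint_sol B a b F <->
  F a = 1%:M /\ forall t, a <= t <= b -> mderiv (seg a b) F t (B t *m F t).
Proof.
by split=> -[Fa Fd]; split=> // t tab; apply/has_deriv_withinP; exact: Fd.
Qed.

(** The criterion asks for an explicit invertible solution rather than regularity of B, because the
    coefficient in the final formula contains a [deriv_within] known only pointwise. *)
Lemma prodintE (B : R -> M) (a x : R) F : a <= x -> F a = 1%:M ->
  (forall t, a <= t <= x -> F t \in unitmx) ->
  (forall t, a <= t <= x -> mderiv (seg a x) F t (B t *m F t)) ->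
  prodint B a x = F x.
Proof.
move=> ax Fa Fu Fd; rewrite /prodint; case: pselect => [h|[]]; last first.
  by exists F; apply/prodint_solP.
case: cid => H /= /prodint_solP[Ha Hd].
by apply: (linear_ode_unique ax _ Fu Fd Hd); rewrite Ha.
Qed.

(** By definition [prodint B a t] solves a separate problem on [a, t] for each t; uniqueness
    identifies all these values with one solution on [a, b]. *)
Lemma prodint_linear_ode (B : R -> M) (a b : R) : a <= b ->
  (forall t, a <= t <= b -> mcont (seg a b) B t) ->
  [/\ prodint B a a = 1%:M,
      forall t, a <= t <= b -> prodint B a t \in unitmx &
      forall t, a <= t <= b ->
        mderiv (seg a b) (prodint B a) t (B t *m prodint B a t)].
Proof.
move=> ab Bc; have [F [Fa Fd]] := linear_ode_exists ab Bc.
have Fu := linear_ode_unit Bc Fa Fd.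
have PF t : a <= t <= b -> prodint B a t = F t.
  move=> /andP[at_ tb]; have sub := seg_subset (lexx a) tb.
  apply: prodintE => // u /sub uab; first exact: Fu.
  by apply: mderivW sub _; exact: Fd.
split.
- by rewrite PF// lexx.
- by move=> t tab; rewrite PF// Fu.
- move=> t tab; rewrite PF//; apply: (@eq_mderiv _ _ _ F) => //; last exact: Fd.
  by move=> u uab; rewrite PF.
Qed.

End product_integral.

(** * Uniform estimates in a parameter *)

Section parameter.
Context {R : realType} {n : nat}.
Local Notation M := 'M[R[i]]_n.
Context (s0 s1 t0 t1 : R).

Lemma rect_continuousP (D : R -> R -> M) s t : s0 <= s <= s1 -> t0 <= t <= t1 ->
  {within rect s0 s1 t0 t1, continuous (fun p : R * R => D p.1 p.2)} ->
  forall e : R, 0 < e -> exists2 k, 0 < k & forall x u, s0 <= x <= s1 ->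
    t0 <= u <= t1 -> `|x - s| < k -> `|u - t| < k -> mnorm (D x u - D s t) <= e.
Proof.
move=> sin tin /subspace_continuousP/(_ (s, t) (conj sin tin)).
move=> /cvg_mnormP Dc e /Dc/near_withinP[k k0 H]; exists k => // x u xin uin xs ut.
by apply: (H (x, u)) => //; split; rewrite /ball /= distrC.
Qed.

(** Compactness of [s0, s1] makes the radius independent of x: near each x, both D y u and D y t are
    within e/2 of D x t. *)
Lemma rect_uniform (D : R -> R -> M) t : t0 <= t <= t1 ->
  {within rect s0 s1 t0 t1, continuous (fun p : R * R => D p.1 p.2)} ->
  forall e : R, 0 < e -> exists2 k, 0 < k & forall x u, s0 <= x <= s1 ->
    t0 <= u <= t1 -> `|u - t| < k -> mnorm (D x u - D x t) <= e.
Proof.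
move=> tin Dc e e0.
have := @segment_compact R s0 s1.
move=> /compact_near_coveringP/near_covering_withinP.
move=> /(_ R (within (seg t0 t1) (nbhs t)) (fun u x => mnorm (D x u - D x t) <= e)).
move=> H; have /near_withinP[k k0 {}H] : \forall u \near within (seg t0 t1) (nbhs t),
    `[s0, s1] `<=` (fun x => mnorm (D x u - D x t) <= e).
  apply: H => x; rewrite /= in_itv /= => xin.
  have e20 : 0 < e / 2 by rewrite divr_gt0.
  have [k k0 kP] := rect_continuousP xin tin Dc e20.
  exists (ball x k, [set u | seg t0 t1 u /\ ball t k u]).
    split; first exact: nbhsx_ballx.
    have := @near_withinP R R (seg t0 t1) t [set u | seg t0 t1 u /\ ball t k u].
    by move=> [_]; apply; exists k.
  move=> [y u] [/= xy [uin tu]]; rewrite in_itv /= => yin.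
  have h1 := kP y u yin uin; have h2 := kP y t yin tin.
  move: h1 h2; rewrite subrr normr0 ![`|_ - x|]distrC ![`|_ - t|]distrC.
  move=> /(_ xy tu) h1 /(_ xy k0) h2.
  have -> : D y u - D y t = (D y u - D x t) - (D y t - D x t).
    by rewrite opprB addrA subrK.
  by apply: le_trans (mnormB _ _) _; lra.
exists k => // x u xin uin ut; apply: (H u uin) => //.
by rewrite /ball /= distrC.
Qed.

(** The mean value inequality for f(v) - v K on the segment between t and u, whichever of the two is
    smaller. It makes first-order remainders uniform once df is uniformly close to K. *)
Lemma mderiv_increment (f df : R -> M) (K : M) t u (e : R) :
  t0 <= t <= t1 -> t0 <= u <= t1 ->
  (forall v, t0 <= v <= t1 -> mderiv (seg t0 t1) f v (df v)) ->
  (forall v, t0 <= v <= t1 -> `|v - t| <= `|u - t| -> mnorm (df v - K) <= e) ->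
  mnorm (f u - f t - (u - t)%:C%C *: K) <= e * `|u - t|.
Proof.
move=> /andP[tt0 tt1] /andP[ut0 ut1] fd dfK.
pose g v := f v - v%:C%C *: K.
have gd v : t0 <= v <= t1 -> mderiv (seg t0 t1) g v (df v - K).
  move=> vin; apply: mderivB; first exact: fd.
  move=> d d0; exists 1 => // w _ _.
  by rewrite -!scalerBl -!rmorphB subrr scale0r mnorm0 mulr_ge0// ltW.
have -> : f u - f t - (u - t)%:C%C *: K = g u - g t.
  by rewrite /g rmorphB scalerBl; apply/matrixP => i j; rewrite !mxE; ring.
have [tu|ut] := leP t u.
- rewrite ger0_norm ?subr_ge0// mulrBr; have sub := seg_subset tt0 ut1.
  apply: (@mderiv_norm_le R n t u g (fun v => df v - K) _ (fun=> e) tu).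
  + by move=> v vin; exact/(mderivW sub)/gd/sub.
  + by move=> v _; exact: rderiv_linear.
  + move=> v vin; apply: dfK; first exact: sub.
    by move: vin => /andP[? ?]; rewrite !ger0_norm; lra.
- rewrite mnormBC ltr0_norm ?subr_lt0// [- (u - t)]opprB mulrBr.
  have sub := seg_subset ut0 tt1.
  apply: (@mderiv_norm_le R n u t g (fun v => df v - K) _ (fun=> e) (ltW ut)).
  + by move=> v vin; exact/(mderivW sub)/gd/sub.
  + by move=> v _; exact: rderiv_linear.
  + move=> v vin; apply: dfK; first exact: sub.
    by move: vin => /andP[? ?]; rewrite !ler0_norm; lra.
Qed.

(* Gronwall without exponentials: bound [D - 1] by its maximum on the segment. *)
Lemma linear_ode_near_id (a b : R) (D E : R -> M) (q : R) : a <= b ->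
  D a = 1%:M ->
  (forall t, a <= t <= b -> mderiv (seg a b) D t (E t *m D t)) ->
  (forall t, a <= t <= b -> mnorm (E t) <= q) ->
  (b - a) * q <= 1 / 2 ->
  forall t, a <= t <= b -> mnorm (D t - 1%:M) <= 2 * ((b - a) * q) * mnorm (1%:M : M).
Proof.
move=> ab Da Dd Eq qs.
have D1d t : a <= t <= b -> mderiv (seg a b) (fun u => D u - 1%:M) t (E t *m D t - 0).
  by move=> tab; apply: mderivB (mderiv_cst _ _ _); exact: Dd.
have [c cab cP] := mcont_max ab (fun t tab => mderiv_cont (D1d t tab)).
set m := mnorm (D c - 1%:M) in cP *; pose N := mnorm (1%:M : M).
have [m0 N0] : 0 <= m /\ 0 <= N by split; exact: mnorm_ge0.
have q0 : 0 <= q by apply: le_trans (Eq a _); rewrite ?mnorm_ge0// lexx.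
have /andP[ac cb] := cab; have sub := seg_subset (lexx a) cb.
(* On the segment |D| <= N + m, with N the norm of the identity in this norm. Combined with (b - a)
   q <= 1/2 this gives m <= (b - a) q N + m / 2. *)
have : m <= q * (N + m) * c - q * (N + m) * a.
  have := @mderiv_norm_le R n a c (fun u => D u - 1%:M) (fun t => E t *m D t - 0)
    ( *%R (q * (N + m))) (fun=> q * (N + m)) ac.
  rewrite Da subrr subr0; apply.
  - by move=> t /sub tab; apply: (mderivW sub); exact: D1d.
  - by move=> t _; exact: rderiv_linear.
  - move=> t /sub tab; rewrite subr0; apply: le_trans (mnormM _ _) _.
    apply: ler_pM; rewrite ?mnorm_ge0 ?Eq//.
    rewrite -[D t](subrK 1%:M) addrC; apply: le_trans (mnormD _ _) _.
    by rewrite lerD2l; exact: cP.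
have NM : 0 <= q * (N + m) by rewrite mulr_ge0// addr_ge0.
have : q * (N + m) * (c - a) <= q * (N + m) * (b - a).
  by apply: ler_wpM2l => //; rewrite lerB.
have : (b - a) * q * m <= 1 / 2 * m by exact: ler_wpM2r.
move=> h1 h2 h3 t tab; apply: le_trans (cP t tab) _.
by move: h1 h2 h3; rewrite -/N; lra.
Qed.

End parameter.

(** * Differentiability of the product integral in its parameter *)

Section parameter_derivative.
Context {R : realType} {n : nat}.
Local Notation M := 'M[R[i]]_n.

(** With B the increment of the coefficient and A its parameter derivative, the left side is the
    derivative of L - 1 - c G. The right side isolates two small factors: the linear remainder B - c
    A, and L - 1. *)
Lemma duhamel_remainder (Y B A F L : M) (c : R[i]) :
  Y *m B *m F *m L - 0 - c *: (Y *m A *m F) =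
  Y *m (B - c *: A) *m F *m L + c *: (Y *m A *m F *m (L - 1%:M)).
Proof.
rewrite subr0 [_ *m (L - _)]mulmxBr mulmx1 scalerBr mulmxBr !mulmxBl.
rewrite -scalemxAr -!scalemxAl.
move: (c *: (_ *m L)) (c *: _) (_ *m L) => X1 X2 X3.
by apply/matrixP => i j; rewrite !mxE; ring.
Qed.

(* Duhamel: with h = u - t and L := P(., t)^-1 P(., u), one has
   L' = P(., t)^-1 (A(., u) - A(., t)) P(., t) L, whence L = 1 + h G + o(h) for
   G the antiderivative of P^-1 (dA/dt) P. *)
Lemma prodint_param_deriv (s0 s1 t0 t1 : R) (A At : R -> R -> M) s t :
  (forall x u, s0 <= x <= s1 -> t0 <= u <= t1 -> mcont (seg s0 s1) (A ^~ u) x) ->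
  (forall x u, s0 <= x <= s1 -> t0 <= u <= t1 ->
    mderiv (seg t0 t1) (A x) u (At x u)) ->
  {within rect s0 s1 t0 t1, continuous (fun p : R * R => At p.1 p.2)} ->
  s0 <= s <= s1 -> t0 <= t <= t1 ->
  exists d, mderiv (seg t0 t1) (fun u => prodint (A ^~ u) s0 s) t d.
Proof.
move=> Ac Ad Atc sin tin; have /andP[s0s ss1] := sin.
have s01 := le_trans s0s ss1.
pose P x u := prodint (A ^~ u) s0 x.
have Pode u : t0 <= u <= t1 -> [/\ P s0 u = 1%:M,
    forall x, s0 <= x <= s1 -> P x u \in unitmx &
    forall x, s0 <= x <= s1 -> mderiv (seg s0 s1) (P ^~ u) x (A x u *m P x u)].
  by move=> uin; apply: prodint_linear_ode => // x xin; exact: Ac.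
pose F x := P x t; have [F0 Fu Fd] : [/\ F s0 = 1%:M,
    forall x, s0 <= x <= s1 -> F x \in unitmx &
    forall x, s0 <= x <= s1 -> mderiv (seg s0 s1) F x (A x t *m F x)] := Pode t tin.
pose Y x := invmx (F x).
have Yd x : s0 <= x <= s1 -> mderiv (seg s0 s1) Y x (- (Y x *m A x t)).
  move=> xin; have := mderivV xin Fu (Fd x xin).
  by rewrite mulmxA (mulmxK (Fu x xin)); exact.
have Fc x xin := mderiv_cont (Fd x xin); have Yc x xin := mderiv_cont (Yd x xin).
have Dc x : s0 <= x <= s1 -> mcont (seg s0 s1) (At ^~ t) x.
  move=> xin e /(rect_continuousP xin tin Atc)[k k0 H]; exists k => // y yin yx.
  by apply: H => //; rewrite subrr normr0.
have [Kf Kf0 FK] := mcont_bounded s01 Fc.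
have [Ky Ky0 YK] := mcont_bounded s01 Yc.
have [Kd Kd0 DK] := mcont_bounded s01 Dc.
have [|G [G0 Gd]] := @mantideriv R n s0 s1 (fun x => Y x *m At x t *m F x) 0 s01.
  by move=> x xin; apply: mcontM (Fc x xin); apply: mcontM (Yc x xin) (Dc x xin).
(* Read off from P(s, u) = F L = F (1 + h G + o(h)). *)
exists (F s *m G s).
pose N := mnorm (1%:M : M); have N0 : 0 <= N := mnorm_ge0 _.
pose l := s1 - s0; have l0 : 0 <= l by rewrite subr_ge0.
pose c1 := Ky * (Kd + 1) * Kf; have c10 : 0 < c1 by rewrite !mulr_gt0// addr_gt0.
pose c2 := 2 * (l * c1) * N.
have c20 : 0 <= c2 := mulr_ge0 (mulr_ge0 (ler0n R 2) (mulr_ge0 l0 (ltW c10))) N0.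
pose c3 := Ky * Kf * (N + c2) + Ky * Kd * Kf * c2.
have yf0 := mulr_ge0 (ltW Ky0) (ltW Kf0).
have ydf0 := mulr_ge0 (mulr_ge0 (ltW Ky0) (ltW Kd0)) (ltW Kf0).
have c30 : 0 <= c3.
  by apply: addr_ge0; apply: mulr_ge0 => //; exact: addr_ge0.
apply: (@mderiv_scale _ _ _ _ _ _ (Kf * (c3 * l))) => e e0.
(* Tolerance 1 gives a Lipschitz bound on A in the parameter, so that the constants do not depend on
   e; tolerance e gives the small remainder. *)
have [k1 k10 U1] := rect_uniform tin Atc ltr01.
have [k2 k20 U2] := rect_uniform tin Atc e0.
pose k3 := (2 * (l * c1 + 1))^-1.
have k3' : 0 < 2 * (l * c1 + 1) by rewrite mulr_gt0// ltr_wpDl// mulr_ge0// ltW.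
(* [k3] secures the hypothesis of [linear_ode_near_id], |h| < 1 bounds L uniformly, and |h| < e
   absorbs the square of |h|. *)
exists (Num.min (Num.min k1 k2) (Num.min k3 (Num.min 1 e))).
  by rewrite !lt_min k10 k20 ltr01 e0 /k3 invr_gt0 k3'.
move=> u uin; rewrite !lt_min /k3 -[(2 * _)^-1]mul1r ltr_pdivlMr//.
set h := u - t; move=> /andP[/andP[hk1 hk2] /and3P[hk3 h1 he]].
have h0 : 0 <= `|h| by exact: normr_ge0.
pose D x := A x u - A x t - h%:C%C *: At x t.
have D1 x : s0 <= x <= s1 -> mnorm (D x) <= 1 * `|h|.
  move=> xin; apply: (mderiv_increment tin uin (fun v => Ad x v xin)).
  by move=> v vin vt; apply: U1 => //; exact: le_lt_trans vt hk1.
have D2 x : s0 <= x <= s1 -> mnorm (D x) <= e * `|h|.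
  move=> xin; apply: (mderiv_increment tin uin (fun v => Ad x v xin)).
  by move=> v vin vt; apply: U2 => //; exact: le_lt_trans vt hk2.
have [Pu0 _ Pud] := Pode u uin.
pose L x := Y x *m P x u.
have PFL x : s0 <= x <= s1 -> P x u = F x *m L x.
  by move=> xin; rewrite /L mulmxA mulmxV ?Fu// mul1mx.
pose E x := Y x *m (A x u - A x t) *m F x.
have Ld x : s0 <= x <= s1 -> mderiv (seg s0 s1) L x (E x *m L x).
  move=> xin; have := mderivM (Yd x xin) (Pud x xin).
  rewrite (_ : _ + _ = E x *m L x)// /E -[_ *m F x *m L x]mulmxA -PFL//.
  by rewrite mulmxBr mulmxBl mulNmx addrC !mulmxA.
have L0 : L s0 = 1%:M by rewrite /L Pu0 mulmx1 /Y F0 invmx1.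
have Eh x : s0 <= x <= s1 -> mnorm (E x) <= c1 * `|h|.
  move=> xin; have -> : c1 * `|h| = Ky * ((Kd + 1) * `|h|) * Kf by rewrite /c1; ring.
  apply: le_trans (mnormM _ _) _; apply: ler_pM; rewrite ?mnorm_ge0 ?FK//.
  apply: le_trans (mnormM _ _) _; apply: ler_pM; rewrite ?mnorm_ge0 ?YK//.
  have -> : A x u - A x t = D x + h%:C%C *: At x t by rewrite /D subrK.
  apply: le_trans (mnormD _ _) _; rewrite mnormZ.
  have := D1 x xin; have := ler_wpM2l h0 (DK x xin); lra.
have L1 x : s0 <= x <= s1 -> mnorm (L x - 1%:M) <= c2 * `|h|.
  move=> xin; have -> : c2 * `|h| = 2 * ((s1 - s0) * (c1 * `|h|)) * N.
    by rewrite /c2 /l; ring.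
  apply: (linear_ode_near_id s01 L0 Ld Eh) => //.
  by move: hk3; rewrite -/l; lra.
have LN x : s0 <= x <= s1 -> mnorm (L x) <= N + c2.
  move=> xin; rewrite -[L x](subrK 1%:M) addrC; apply: le_trans (mnormD _ _) _.
  rewrite lerD2l; apply: le_trans (L1 x xin) _.
  by rewrite ler_piMr// ltW.
(* Z vanishes at s0 and has derivative O(e |h|), so the mean value inequality bounds it by O(e |h|)
   at s. *)
pose Z x := L x - 1%:M - h%:C%C *: G x.
pose dZ x := Y x *m D x *m F x *m L x +
             h%:C%C *: (Y x *m At x t *m F x *m (L x - 1%:M)).
have Zd x : s0 <= x <= s1 -> mderiv (seg s0 s1) Z x (dZ x).
  move=> xin; rewrite /dZ /D -duhamel_remainder.
  apply: mderivB (mderivZ h (Gd x xin)).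
  exact: mderivB (Ld x xin) (mderiv_cst _ _ _).
have dZh x : s0 <= x <= s1 -> mnorm (dZ x) <= c3 * (e * `|h|).
  move=> xin.
  have b1 : mnorm (Y x *m D x *m F x *m L x) <= Ky * (e * `|h|) * Kf * (N + c2).
    apply: le_trans (mnormM _ _) _; apply: ler_pM; rewrite ?mnorm_ge0 ?LN//.
    apply: le_trans (mnormM _ _) _; apply: ler_pM; rewrite ?mnorm_ge0 ?FK//.
    by apply: le_trans (mnormM _ _) _; apply: ler_pM; rewrite ?mnorm_ge0 ?YK ?D2.
  have b2 : mnorm (Y x *m At x t *m F x *m (L x - 1%:M)) <=
      Ky * Kd * Kf * (c2 * `|h|).
    apply: le_trans (mnormM _ _) _; apply: ler_pM; rewrite ?mnorm_ge0 ?L1//.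
    apply: le_trans (mnormM _ _) _; apply: ler_pM; rewrite ?mnorm_ge0 ?FK//.
    by apply: le_trans (mnormM _ _) _; apply: ler_pM; rewrite ?mnorm_ge0 ?YK ?DK.
  apply: le_trans (mnormD _ _) _; rewrite mnormZ.
  have b3 := ler_wpM2l h0 b2.
  have b4 : `|h| * `|h| <= e * `|h| by rewrite ler_wpM2r// ltW.
  apply: le_trans (lerD b1 b3) _.
  have -> : Ky * (e * `|h|) * Kf * (N + c2) = Ky * Kf * (N + c2) * (e * `|h|) by ring.
  have -> : `|h| * (Ky * Kd * Kf * (c2 * `|h|)) = Ky * Kd * Kf * c2 * (`|h| * `|h|).
    by ring.
  by rewrite /c3 [leRHS]mulrDl lerD2l; exact: (ler_wpM2l (mulr_ge0 ydf0 c20) b4).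
have Zs : mnorm (Z s) <= c3 * l * (e * `|h|).
  have sub := seg_subset (lexx s0) ss1.
  have := @mderiv_norm_le R n s0 s Z dZ ( *%R (c3 * (e * `|h|)))
    (fun=> c3 * (e * `|h|)) s0s.
  have -> : Z s0 = 0 by rewrite /Z L0 subrr G0 scaler0 subr0.
  rewrite subr0 => H.
  apply: le_trans (H _ _ _) _.
  - by move=> x /sub xin; apply: (mderivW sub); exact: Zd.
  - by move=> x _; exact: rderiv_linear.
  - by move=> x /sub; exact: dZh.
  have ceh0 := mulr_ge0 c30 (mulr_ge0 (ltW e0) h0).
  by have := ler_wpM2l ceh0 (lerB ss1 (lexx s0)); rewrite /l; lra.
rewrite -/(P s u) -/(P s t) -/(F s).
have -> : P s u - F s - h%:C%C *: (F s *m G s) = F s *m Z s.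
  by rewrite PFL// /Z !mulmxBr mulmx1 scalemxAr.
apply: le_trans (mnormM _ _) _; rewrite -mulrA.
by apply: ler_pM; rewrite ?mnorm_ge0 ?FK.
Qed.

End parameter_derivative.

(** * The differential equation of the loop operator *)

Lemma loop_deriv (R : realType) (n : nat) (T T' A Q P : 'M[R[i]]_n) :
  T \in unitmx ->
  (- (invmx T *m T' *m invmx T) *m Q + invmx T *m (A *m Q)) *m P
    + invmx T *m Q *m 0 =
  invmx T *m (A - T' *m invmx T) *m T *m (invmx T *m Q *m P).
Proof.
move=> Tu; rewrite mulmx0 addr0 2!mulmxA (mulmxK Tu) mulmxBr mulmxDl !mulmxBl.
by rewrite addrC !mulNmx !mulmxA.
Qed.

Unset Implicit Arguments.
Set Strict Implicit.

Theorem theorem1 (R : realType) (n : nat) (s0 s1 t0 t1 : R)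
  (A0 A1 : R -> R -> 'M[R[i]]_n) :
  C1_rect A0 s0 s1 t0 t1 -> C1_rect A1 s0 s1 t0 t1 ->
  let P := fun s t => prodint (fun s' => A1 s' t) s0 s in
  let Q := fun s t => prodint (fun t' => A0 s t') t0 t in
  let T := fun s t => P s t *m Q s0 t in
  forall s t, s0 <= s <= s1 -> t0 <= t <= t1 ->
  let W := invmx (Q s0 t) *m invmx (P s t) *m Q s t *m P s t0 in
  W = invmx (T s t) *m Q s t *m P s t0 /\
  W = prodint (fun t' => invmx (T s t') *m
         (A0 s t' - deriv_within [set u | t0 <= u <= t1] (T s) t' *m invmx (T s t'))
         *m T s t') t0 t.
Proof.
move=> [_ [A0t [_ [A0d _]]]] [A1s [A1t [A1ds [A1dt [_ [_ A1tc]]]]]] P Q T s t sin tin W.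
have /andP[s0s ss1] := sin; have /andP[t0t tt1] := tin.
have s01 := le_trans s0s ss1; have t01 := le_trans t0t tt1.
have s0in : s0 <= s0 <= s1 by rewrite lexx.
have t0in : t0 <= t0 <= t1 by rewrite lexx.
have Qode x : s0 <= x <= s1 -> [/\ Q x t0 = 1%:M,
    forall u, t0 <= u <= t1 -> Q x u \in unitmx &
    forall u, t0 <= u <= t1 -> mderiv (seg t0 t1) (Q x) u (A0 x u *m Q x u)].
  move=> xin; apply: prodint_linear_ode => // u uin.
  by apply: mderiv_cont; apply/has_deriv_withinP; exact: A0d.
have A1c x u : s0 <= x <= s1 -> t0 <= u <= t1 -> mcont (seg s0 s1) (A1 ^~ u) x.
  by move=> xin uin; apply: mderiv_cont; apply/has_deriv_withinP; exact: A1ds.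
have Pu u : t0 <= u <= t1 -> P s u \in unitmx.
  move=> uin; have [|_ + _] := @prodint_linear_ode R n (A1 ^~ u) s0 s1 s01.
    by move=> x xin; exact: A1c.
  exact.
have [Q0 Qu Qd] := Qode s sin; have [Q00 Qu0 Qd0] := Qode s0 s0in.
have Tu u : t0 <= u <= t1 -> T s u \in unitmx.
  by move=> uin; rewrite unitmx_mul Pu ?Qu0.
pose T' := deriv_within (seg t0 t1) (T s).
(* Existence of a derivative rules out the default value 0 of [deriv_within]; whichever derivative
   is chosen then satisfies [mderiv]. *)
have Td u : t0 <= u <= t1 -> mderiv (seg t0 t1) (T s) u (T' u).
  move=> uin; rewrite /T' /deriv_within; case: pselect => [hd|[]].
    by case: cid => d /= /has_deriv_withinP.
  have [|d Pd] := prodint_param_deriv A1c _ A1tc sin uin.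
    by move=> x v xin vin; apply/has_deriv_withinP; exact: A1dt.
  exists (d *m Q s0 u + P s u *m (A0 s0 u *m Q s0 u)).
  by apply/has_deriv_withinP; exact: mderivM Pd (Qd0 u uin).
have invT : invmx (Q s0 t) *m invmx (P s t) = invmx (T s t).
  have TV : invmx (Q s0 t) *m invmx (P s t) *m T s t = 1%:M.
    by rewrite /T mulmxA -[_ *m P s t]mulmxA mulVmx ?Pu// mulmx1 mulVmx ?Qu0.
  by rewrite -[LHS]mulmx1 -(mulmxV (Tu t tin)) mulmxA TV mul1mx.
have WE : W = invmx (T s t) *m Q s t *m P s t0 by rewrite /W invT.
split=> //; rewrite WE; apply/esym.
(* Only the upper end of the tau-interval varies, so P(s, t0) is a constant factor; at t0 both Q
   factors are 1 and V reduces to P^-1 P = 1. *)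
pose V u := invmx (T s u) *m Q s u *m P s t0.
have sub := seg_subset (lexx t0) tt1.
apply: (@prodintE R n _ t0 t V t0t).
- by rewrite /V /T Q0 Q00 !mulmx1 (mulVmx (Pu _ t0in)).
- by move=> u /sub uin; rewrite !unitmx_mul unitmx_inv (Tu u uin) (Qu u uin) (Pu _ t0in).
(* T is differentiated relative to [t0, t1], while the product integral lives on [t0, t]; the
   equation is proved on the larger segment and restricted. *)
move=> u /sub uin; apply: (mderivW sub).
rewrite -(loop_deriv _ _ _ _ (Tu u uin)).
apply: mderivM (mderiv_cst _ _ _).
exact: mderivM (mderivV uin Tu (Td u uin)) (Qd u uin).
Qed.
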